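(* Let $G=(V,E,w)$ be a finite connected graph with $|V|=n\ge2$ and weights $w:E\to\mathbb{R}_{>0}$. Let $T\in\mathcal T_{\mathrm{conn}}^{\mathrm{bin}}(G)$ satisfy $$F(T)\le\alpha\operatorname{OPT}_{\mathrm{free}}(G,w)$$ for some $\alpha\ge1$. Suppose that a function $\Phi:[1,n-1]\to\mathbb R_{\ge0}$ satisfies $$\mu_T\bigl(\{S:\rho_T(S)>t\}\bigr)\le\Phi(t)\qquad\text{for every }t\in[1,n-1].$$ Then $$\operatorname{OPT}_{\mathrm{card}}(G,w)\le\alpha\left(1+\int_1^{n-1}\Phi(t)\,dt\right)\operatorname{OPT}_{\mathrm{free}}(G,w).$$
   Context: $d_G$ is the shortest-path metric of $(V,E)$ with every edge of length $1$ (weights are not lengths); $\operatorname{diam}_{d_G}(S)=\max_{a,b\in S}d_G(a,b)$. A rooted binary hierarchy $T$ on $V$ is a rooted tree whose leaves are the vertices of $V$ and whose internal nodes have exactly two children; each node is identified with the set of leaves below it (a cluster); $C_T(x,y)$ is the cluster of the lowest common ancestor of $x,y$. $\mathcal T_{\mathrm{conn}}^{\mathrm{bin}}(G)$ is the set of rooted binary hierarchies on $V$ all of whose clusters induce connected subgraphs of $G$. $\mathcal I(T)$ is the family of internal (non-leaf) clusters. For $S\in\mathcal I(T)$ with children $S^0,S^1$: $b_T(S)$ is the total weight of edges with one endpoint in $S^0$ and the other in $S^1$; $\Delta_T(S)=\operatorname{diam}_{d_G}(S)$; $a_T(S)=\Delta_T(S)b_T(S)$; $\rho_T(S)=(|S|-1)/\Delta_T(S)$.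 $F(T)=\sum_{xy\in E}w_{xy}\operatorname{diam}_{d_G}(C_T(x,y))>0$, and $\mu_T(S)=a_T(S)/F(T)$ for $S\in\mathcal I(T)$, which defines a probability measure on $\mathcal I(T)$; the set $\{S:\rho_T(S)>t\}$ consists of clusters $S\in\mathcal I(T)$. $\operatorname{OPT}_{\mathrm{free}}(G,w)$ is the minimum of $\sum_{xy\in E}w_{xy}u(x,y)$ over all ultrametrics $u$ on $V$ (metrics with $u(x,y)\le\max\{u(x,z),u(z,y)\}$ for all $x,y,z$) with $u\ge d_G$ on all pairs. For a rooted binary hierarchy $H$ on $V$ put $h_H(x,x)=0$ and $h_H(x,y)=|C_H(x,y)|-1$ for $x\ne y$; $\operatorname{OPT}_{\mathrm{card}}(G,w)$ is the minimum of $\sum_{xy\in E}w_{xy}h_H(x,y)$ over all rooted binary hierarchies $H$ on $V$ with $h_H\ge d_G$ on all pairs. *)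

(* Defs.v *)
From HB Require Import structures.
From mathcomp Require Import all_boot all_order all_algebra.
From mathcomp Require Import all_classical all_reals all_analysis.

Set Implicit Arguments.
Unset Strict Implicit.
Unset Printing Implicit Defensive.

Import Order.TTheory GRing.Theory Num.Theory.

Local Open Scope ring_scope.

(* A finite simple weighted graph on V. Only the values of wt on adjacent
   pairs are meaningful, and every use of wt below is guarded by adj. *)
Record wgraph (R : realType) (V : finType) := WGraph {
  adj : rel V;
  adj_sym : symmetric adj;
  adj_irrefl : irreflexive adj;
  wt : V -> V -> R;
  wt_sym : forall x y, adj x y -> wt x y = wt y x;
  wt_gt0 : forall x y, adj x y -> 0 < wt x y
}.

(* The internal nodes of a tree in which every internal node has exactly two
   children; the left/right order of the children is irrelevant below. *)
Inductive btree (V : Type) : Type :=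
| BLeaf of V
| BNode of btree V & btree V.

Section Trees.
Variable V : finType.
Implicit Types (T : btree V) (x y : V).

Fixpoint leaves T : seq V :=
  match T with
  | BLeaf x => [:: x]
  | BNode l r => leaves l ++ leaves r
  end.

Definition cluster T : {set V} := [set x in leaves T]%SET.

(* Every vertex of V labels exactly one leaf. *)
Definition is_hierarchy T : bool := perm_eq (leaves T) (enum V).

(* A node is represented by the subtree rooted at it. In a hierarchy distinct
   nodes have distinct clusters. *)
Fixpoint nodes T : seq (btree V) :=
  T :: match T with
       | BLeaf _ => [::]
       | BNode l r => nodes l ++ nodes r
       end.

Definition is_internal T : bool := if T is BNode _ _ then true else false.

Definition internal_nodes T : seq (btree V) :=
  [seq S <- nodes T | is_internal S].

(* Cluster of the deepest node whose cluster contains both x and y, for x and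
   y among the leaves of T. *)
Fixpoint lca_cluster T x y : {set V} :=
  match T with
  | BLeaf a => [set a]%SET
  | BNode l r =>
      if (x \in leaves l) && (y \in leaves l) then lca_cluster l x y
      else if (x \in leaves r) && (y \in leaves r) then lca_cluster r x y
      else cluster T
  end.

Definition card_height T x y : nat :=
  if x == y then 0%N else (#|lca_cluster T x y| - 1)%N.

End Trees.

Section Graphs.
Variables (R : realType) (V : finType) (G : wgraph R V).
Implicit Types (T S : btree V) (A : {set V}) (x y : V) (g u : V -> V -> R).

Definition connected_graph : Prop := forall x y, connect (adj G) x y.

Definition induces_connected A : bool :=
  [forall x in A, forall y in A,
     connect [rel a b | [&& a \in A, b \in A & adj G a b]] x y].

Definition conn_hierarchy T : bool :=
  is_hierarchy T && all (fun S => induces_connected (cluster S)) (nodes T).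

(* Least number of edges of a walk from x to y. The default value #|V| is only
   taken when there is no walk. *)
Definition gdist x y : nat :=
  \big[minn/#|V|]_(k < #|V| |
     [exists p : k.-tuple V, path (adj G) x p && (last x p == y)]) (k : nat).

Definition diam A : nat := \max_(x in A) \max_(y in A) gdist x y.

(* \sum_(xy in E) w_xy g(x, y); the rank condition selects one of the two
   orderings of each edge, and g is always symmetric. *)
Definition edge_sum g : R :=
  \sum_x \sum_(y | adj G x y && (enum_rank x < enum_rank y)%N) wt G x y * g x y.

Definition Fcost T : R := edge_sum (fun x y => (diam (lca_cluster T x y))%:R).

Definition cut_weight S : R :=
  match S with
  | BLeaf _ => 0
  | BNode S0 S1 =>
      \sum_(x in cluster S0) \sum_(y in cluster S1 | adj G x y) wt G x y
  end.

Definition node_diam S : R := (diam (cluster S))%:R.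
Definition node_mass S : R := node_diam S * cut_weight S.
Definition node_ratio S : R := (#|cluster S| - 1)%N%:R / node_diam S.

(* The measure mu_T of the set of internal nodes of T satisfying P. *)
Definition mu T (P : pred (btree V)) : R :=
  \sum_(S <- internal_nodes T | P S) node_mass S / Fcost T.

Definition is_metric u : Prop :=
  [/\ forall x y, 0 <= u x y,
      forall x y, u x y = 0 <-> x = y,
      forall x y, u x y = u y x
    & forall x y z, u x y <= u x z + u z y].

Definition is_ultrametric u : Prop :=
  is_metric u /\ forall x y z, u x y <= Num.max (u x z) (u z y).

Definition free_values : set R :=
  [set edge_sum u | u in
     [set u | is_ultrametric u /\ forall x y, (gdist x y)%:R <= u x y]]%classic.

Definition card_values : set R :=
  [set edge_sum (fun x y => (card_height H x y)%:R) | H in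
     [set H | is_hierarchy H /\
              forall x y, (gdist x y <= card_height H x y)%N]]%classic.

(* Both infima are attained: see OPT_free_min and, as soon as there is a
   connected hierarchy, OPT_card_min. *)
Definition OPT_free : R := inf free_values.
Definition OPT_card : R := inf card_values.

End Graphs.

Definition is_minimum (R : realType) (A : set R) (m : R) : Prop :=
  A m /\ forall a, A a -> m <= a.

Section Minima.
Variables (R : realType) (V : finType) (G : wgraph R V).
Implicit Types (x y z : V) (u g : V -> V -> R).

Lemma finite_inf_min (A : set R) (C : finType) (g : C -> R) :
    (A !=set0)%classic -> (forall a, A a -> exists c, A (g c) /\ g c <= a) ->
  is_minimum A (inf A).
Proof.
move=> [a0 Aa0] H; have [c0 [Ac0 _]] := H _ Aa0.
have := @arg_minP _ _ _ c0 (fun c => `[< A (g c) >]) g.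
case; first exact/asboolP.
move=> c /asboolP Ac cmin.
have lb a : A a -> g c <= a.
  by move=> /H [d [Ad]]; apply: le_trans; apply: cmin; apply/asboolP.
suff -> : inf A = g c by split.
apply/eqP; rewrite eq_le; apply/andP; split.
  by apply: ge_inf => //; exists (g c) => a /lb.
by apply: lb_le_inf; [exists a0 | move=> a /lb].
Qed.

Lemma gdist_le_card x y : (gdist G x y <= #|V|)%N.
Proof.
rewrite /gdist; elim/big_ind: _ => [//|m n hm hn|k _]; last exact/ltnW.
by rewrite geq_min hm.
Qed.

Lemma card_gt0 x : (0 < #|V|)%N.
Proof. by apply/card_gt0P; exists x. Qed.

Lemma gdist_le_path x p : path (adj G) x p ->
  (gdist G x (last x p) <= size p)%N.
Proof.
move=> xp; have [pV|] := ltnP (size p) #|V|; last first.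
  exact: leq_trans (gdist_le_card _ _).
rewrite /gdist; have := mem_index_enum (Ordinal pV).
elim: (index_enum _) => //= k r IH; rewrite inE big_cons => /orP[/eqP <-|/IH h].
  rewrite ifT ?geq_min ?leqnn //.
  by apply/existsP; exists (in_tuple p); rewrite /= xp eqxx.
by case: ifP => // _; rewrite geq_min h orbT.
Qed.

Lemma gdist_xx x : gdist G x x = 0%N.
Proof. by apply/eqP; rewrite -leqn0 (@gdist_le_path x [::]). Qed.

Lemma gdist_le_connected (A : {set V}) x y : induces_connected G A ->
  x \in A -> y \in A -> (gdist G x y <= #|A| - 1)%N.
Proof.
move=> /forall_inP cA xA yA; have /forall_inP/(_ y yA) := cA x xA.
move=> /connectP[p pxp ->]; case/shortenP: pxp => q xq uq _.
have qA : all [in A] q.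
  elim: q x xA xq {uq cA} => //= a q IH x xA /andP[/and3P[_ aA _] aq].
  by rewrite aA (IH a).
have sq : (size q < #|A|)%N.
  rewrite cardE; apply: (uniq_leq_size uq) => a; rewrite inE mem_enum.
  by move=> /orP[/eqP ->|/(allP qA)].
apply: leq_trans (gdist_le_path _) _; last by rewrite leq_subRL ?add1n //; case: #|A| sq.
by apply: sub_path xq => a b /and3P[].
Qed.

Lemma lca_clusterP (P : pred {set V}) T x y :
    all (fun S => P (cluster S)) (nodes T) -> x \in leaves T -> y \in leaves T ->
  [/\ P (lca_cluster T x y), x \in lca_cluster T x y & y \in lca_cluster T x y].
Proof.
elim: T => [a|l IHl r IHr] /=.
  rewrite andbT !inE => Pa /eqP -> /eqP ->; rewrite eqxx; split => //.
  by rewrite (_ : [set a]%SET = cluster (BLeaf a)) //; apply/setP => b; rewrite !inE.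
rewrite all_cat => /and3P[PT Pl Pr] xT yT.
case: ifP => [/andP[xl yl]|_]; first exact: IHl.
case: ifP => [/andP[xr yr]|_]; first exact: IHr.
by rewrite !inE.
Qed.

Lemma gdist_gt0 x y : x != y -> (0 < gdist G x y)%N.
Proof.
move=> xy; rewrite /gdist; elim/big_ind: _ => [|m n hm hn|[k hk] /= /existsP[p]].
- exact: card_gt0 x.
- by rewrite leq_min hm.
- by case: k hk p => // hk p; rewrite tuple0 /= (negbTE xy).
Qed.

Lemma eq_edge_sum g h : g =2 h -> edge_sum G g = edge_sum G h.
Proof.
by move=> gh; apply: eq_bigr => x _; apply: eq_bigr => y _; rewrite gh.
Qed.

Lemma le_edge_sum g h : (forall x y, g x y <= h x y) ->
  edge_sum G g <= edge_sum G h.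
Proof.
move=> gh; apply: ler_sum => x _; apply: ler_sum => y /andP[xy _].
by rewrite ler_wpM2l // ltW // wt_gt0.
Qed.

(* Every feasible ultrametric dominates the one giving x, y the diameter of
   their ball, which takes values in {0, ..., |V|}. *)
Definition ball_diam u x y : nat :=
  \max_(a | (u x a <= u x y)%R) \max_(b | (u x b <= u x y)%R) gdist G a b.

Lemma ball_diam_feasible u : is_ultrametric u ->
    (forall x y, (gdist G x y)%:R <= u x y) ->
  [/\ is_ultrametric (fun x y => (ball_diam u x y)%:R : R),
      forall x y, (gdist G x y <= ball_diam u x y)%N,
      forall x y, (ball_diam u x y)%:R <= u x y
    & forall x y, (ball_diam u x y <= #|V|)%N].
Proof.
move=> [[u0 ueq usym utri] uultra] ud.
have mono x y z t : (forall a, u x a <= u x y -> u z a <= u z t) ->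
    (ball_diam u x y <= ball_diam u z t)%N.
  move=> h; apply/bigmax_leqP => a /h za; apply/bigmax_leqP => b /h zb.
  rewrite /ball_diam; apply: leq_trans (leq_bigmax_cond _ za).
  exact: (@leq_bigmax_cond _ _ (gdist G a) b zb).
have ball x y a : u x a <= u x y -> u y a <= u y x.
  move=> h; apply: le_trans (uultra y a x) _.
  by rewrite ge_max lexx /= (le_trans h) // usym.
have sym x y : ball_diam u x y = ball_diam u y x.
  by apply/eqP; rewrite eqn_leq !mono // => a; apply: ball.
have dle x y : (gdist G x y <= ball_diam u x y)%N.
  have hx : u x x <= u x y by rewrite (iffRL (ueq x x)).
  apply: leq_trans (leq_bigmax_cond _ hx).
  exact: (@leq_bigmax_cond _ _ (gdist G x) y (lexx (u x y))).
have ultra x y z :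
    (ball_diam u x y <= maxn (ball_diam u x z) (ball_diam u z y))%N.
  rewrite leq_max; have := uultra x y z; rewrite le_max => /orP[] h.
    by rewrite mono // => a /le_trans; apply.
  apply/orP; right; rewrite sym (sym z) mono // => a /le_trans; apply.
  by rewrite usym (usym y).
split => //.
- split; [split|] => //.
  + move=> x y; split => [/eqP|<-].
      rewrite pnatr_eq0 => /eqP h; apply/eqP/negPn/negP => /gdist_gt0 d0.
      by have := leq_trans d0 (dle x y); rewrite h.
    apply/eqP; rewrite pnatr_eq0 -leqn0; apply/bigmax_leqP => a xa.
    apply/bigmax_leqP => b xb.
    have c0 c : u x c <= u x x -> c = x.
      rewrite (iffRL (ueq x x) erefl) => h; apply/esym/ueq/eqP.
      by rewrite eq_le h u0.
    by rewrite (c0 a) // (c0 b) // gdist_xx.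
  + by move=> x y; rewrite sym.
  + move=> x y z; rewrite -natrD ler_nat (leq_trans (ultra x y z)) //.
    by rewrite geq_max leq_addr leq_addl.
  + by move=> x y z; rewrite -natr_max ler_nat ultra.
- move=> x y.
  have : (fun n : nat => n%:R <= u x y) (ball_diam u x y).
    rewrite /ball_diam; elim/big_ind: _ => [|m n hm hn|a xa] //.
      by rewrite natr_max ge_max hm.
    elim/big_ind: _ => [|m n hm hn|b xb] //.
      by rewrite natr_max ge_max hm.
    apply: le_trans (ud a b) _; apply: le_trans (uultra a b x) _.
    by rewrite ge_max xb andbT usym.
  by [].
- move=> x y; apply/bigmax_leqP => a _; apply/bigmax_leqP => b _.
  exact: gdist_le_card.
Qed.

Lemma OPT_free_min : is_minimum (free_values G) (OPT_free G).
Proof.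
pose C : finType := {ffun V * V -> 'I_#|V|.+1}.
apply: (@finite_inf_min _ C
  (fun c => edge_sum G (fun x y => (c (x, y) : nat)%:R))).
  pose u x y : R := if x == y then 0 else #|V|%:R.
  have Vge0 : 0 <= #|V|%:R :> R by [].
  exists (edge_sum G u); exists u => //; split; last first.
    move=> x y; rewrite /u; case: eqVneq => [->|_]; first by rewrite gdist_xx.
    by rewrite ler_nat gdist_le_card.
  split; [split|].
  - by move=> x y; rewrite /u; case: ifP.
  - move=> x y; rewrite /u; case: eqVneq => // xy; split => /eqP; last by rewrite (negbTE xy).
    by rewrite pnatr_eq0 => /eqP V0; have := card_gt0 x; rewrite V0.
  - by move=> x y; rewrite /u eq_sym.
  - move=> x y z; rewrite /u; case: (eqVneq x y) => [_|xy].
      by apply: addr_ge0; case: ifP.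
    case: (eqVneq x z) => [<-|_]; first by rewrite (negbTE xy) add0r.
    by rewrite lerDl; case: ifP.
  - move=> x y z; rewrite /u le_max; case: (eqVneq x y) => [_|xy].
      by case: ifP; rewrite ?lexx ?Vge0.
    case: (eqVneq x z) => [<-|_]; first by rewrite (negbTE xy) lexx orbT.
    by rewrite lexx.
move=> _ [u [uu ud] <-].
have [bu bd bl bV] := ball_diam_feasible uu ud.
exists [ffun p => inord (ball_diam u p.1 p.2)].
have E : edge_sum G (fun x y => ([ffun p => inord (ball_diam u p.1 p.2)]
    (x, y) : 'I_#|V|.+1)%:R) = edge_sum G (fun x y => (ball_diam u x y)%:R).
  by apply: eq_edge_sum => x y; rewrite ffunE inordK // ltnS bV.
rewrite E; split; last exact: le_edge_sum.
by exists (fun x y => (ball_diam u x y)%:R) => //; split => // x y; rewrite ler_nat.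
Qed.

Lemma conn_hierarchy_feasible T x y : conn_hierarchy G T ->
  (gdist G x y <= card_height T x y)%N.
Proof.
move=> /andP[hT cT]; rewrite /card_height.
case: eqVneq => [->|_]; first by rewrite gdist_xx.
have inT z : z \in leaves T by rewrite (perm_mem hT) mem_enum.
have [cA xA yA] := lca_clusterP cT (inT x) (inT y).
exact: gdist_le_connected.
Qed.

Lemma OPT_card_min T : conn_hierarchy G T ->
  is_minimum (card_values G) (OPT_card G).
Proof.
move=> cT; pose C : finType := {ffun V * V -> 'I_#|V|.+1}.
have ne : (card_values G !=set0)%classic.
  exists (edge_sum G (fun x y => (card_height T x y)%:R)); exists T => //.
  split; first by case/andP: cT.
  by move=> x y; apply: conn_hierarchy_feasible.
apply: (@finite_inf_min _ C
  (fun c => edge_sum G (fun x y => (c (x, y) : nat)%:R))) => //.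
move=> _ [H Hf <-]; exists [ffun p => inord (card_height H p.1 p.2)].
have -> : edge_sum G (fun x y => ([ffun p => inord (card_height H p.1 p.2)]
    (x, y) : 'I_#|V|.+1)%:R) = edge_sum G (fun x y => (card_height H x y)%:R).
  apply: eq_edge_sum => x y; rewrite ffunE inordK // ltnS /card_height.
  by case: ifP => // _; rewrite (leq_trans (leq_subr _ _)) // max_card.
by split => //; exists H.
Qed.

End Minima.

(* Main.v *)
(* T itself is a feasible hierarchy for OPT_card. Grouping the edges xy by the
   node separating x from y, its cardinality cost is the sum over the internal
   nodes S of (|S| - 1) b(S) = rho(S) a(S), while F(T) is the sum of the a(S).
   Hence the cost is F(T) (1 + \sum_S mu(S) (rho(S) - 1)). Connectedness of the
   clusters gives 1 <= rho(S) <= n - 1, so rho(S) - 1 is the integral over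
   [1, n - 1] of the indicator of t < rho(S); summing over S yields the integral
   of the tail mu(rho > t), which Phi dominates. *)
Require Import Defs.
From HB Require Import structures.
From mathcomp Require Import all_boot all_order all_algebra.
From mathcomp Require Import all_classical all_reals all_analysis.
From mathcomp Require Import measurable_realfun.

Import Order.TTheory GRing.Theory Num.Theory.

Local Open Scope ring_scope.

(* The analysis library also has a cluster, for filters. *)
Local Notation cluster := Defs.cluster.

(** * Integrals of tails over an interval starting at 1 *)

(* No measurability is assumed of g (Phi need not be measurable): the integral
   of a nonnegative function is a supremum over the simple functions below it. *)
Lemma le_integral_ge0 d (T : measurableType d) (R : realType)
    (m : {measure set T -> \bar R}) (D : set T) (f g : T -> \bar R) :
    (forall x, D x -> (0 <= f x)%E) -> (forall x, D x -> (f x <= g x)%E) ->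
  (\int[m]_(x in D) f x <= \int[m]_(x in D) g x)%E.
Proof.
move=> f0 fg.
have g0 x : D x -> (0 <= g x)%E by move=> Dx; exact: le_trans (f0 x Dx) (fg x Dx).
rewrite [leLHS]integral_mkcond [leRHS]integral_mkcond.
rewrite !ge0_integralTE; try by move=> x; exact: erestrict_ge0.
apply: ereal_sup_le => _ [h hf <-]; exists h => // x.
by apply: le_trans (hf x) _; exact: lee_restrict.
Qed.

Lemma integral_lt_indicator (R : realType) (b c : R) : 1 <= c <= b ->
  (\int[lebesgue_measure]_(t in `[1%R, b]%classic) ((t < c)%R%:R)%:E = (c - 1)%:E)%E.
Proof.
move=> /andP[c1 cb].
have E t : ((t < c)%R%:R)%:E = (\1_(`]-oo, c[%classic : set R) t)%:E :> \bar R.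
  by rewrite indicE; congr (_%:R%:E); rewrite mem_setE in_itv.
under eq_integral do rewrite E.
rewrite integral_indic //.
rewrite (_ : (_ `&` _)%classic = `[1%R, c[%classic :> set R); last first.
  apply/seteqP; split => t /=; rewrite !in_itv /=; first by move=> [-> /andP[->]].
  by move=> /andP[-> tc]; rewrite tc (ltW (lt_le_trans tc cb)).
(* The measure formula branches on [1 < c]; in the other branch [c = 1], the interval is empty and
   both sides are 0. *)
apply: (etrans (lebesgue_measure_itv `[1%R, c[)); rewrite /= lte_fin; case: ltP => // c1'.
by rewrite (le_anti (_ : 1 <= c <= 1)) ?subrr // c1 c1'.
Qed.

(** The sum is finite, so it commutes with the integral, and index [i] contributes [m i] times the
    length of [[1, c i[]. *)
Lemma layer_cake (R : realType) (I : finType) (m c : I -> R) (b : R) :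
    (forall i, 0 <= m i) -> (forall i, 1 <= c i <= b) ->
  (\int[lebesgue_measure]_(t in `[1%R, b]%classic)
      (\sum_(i | (t < c i)%R) m i)%:E = (\sum_i m i * (c i - 1))%:E)%E.
Proof.
move=> m0 cb.
have E t : (\sum_(i | (t < c i)%R) m i)%:E =
    (\sum_i (m i)%:E * ((t < c i)%R%:R)%:E)%E.
  rewrite big_mkcond -sumEFin; apply: eq_bigr => i _; rewrite -EFinM.
  by case: ifP; rewrite ?mulr1 ?mulr0.
under eq_integral do rewrite E.
have meas i : measurable_fun (`[1%R, b]%classic : set R)
    (fun t : R => (t < c i)%R%:R : R).
  apply: (measurable_funS measurableT) => //.
  have -> : (fun t : R => (t < c i)%R%:R) = \1_(`]-oo, c i[%classic) :> (R -> R).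
    by apply/funext => t; rewrite indicE mem_setE in_itv.
  exact: measurable_indic.
rewrite ge0_integral_sum //=.
- rewrite -sumEFin; apply: eq_bigr => i _.
  rewrite ge0_integralZl_EFin ?integral_lt_indicator //.
  by apply/measurable_EFinP; exact: meas.
- by move=> i; apply: measurable_funeM; apply/measurable_EFinP; exact: meas.
- by move=> i t _; rewrite -EFinM lee_fin mulr_ge0.
Qed.

(** * Costs of a hierarchy as sums over internal nodes *)

Section Hierarchy.
Variables (R : realType) (V : finType) (G : wgraph R V).
Implicit Types (T S : btree V) (x y : V).

Lemma internal_nodes_node (l r : btree V) :
  internal_nodes (BNode l r) = BNode l r :: internal_nodes l ++ internal_nodes r.
Proof. by rewrite /internal_nodes /= filter_cat. Qed.

Lemma leaves_gt0 T : (0 < size (leaves T))%N.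
Proof. by elim: T => //= l IHl r _; rewrite size_cat addn_gt0 IHl. Qed.

Lemma uniq_leaves_nodes T : uniq (leaves T) ->
  all (fun S => uniq (leaves S)) (nodes T).
Proof.
elim: T => //= l IHl r IHr ulr; rewrite ulr all_cat.
by move: ulr; rewrite cat_uniq => /and3P[/IHl -> _ /IHr ->].
Qed.

Lemma card_cluster T : uniq (leaves T) -> #|cluster T| = size (leaves T).
Proof. by move=> /card_uniqP <-; apply: eq_card => x; rewrite inE. Qed.

Lemma card_internal_gt1 S : uniq (leaves S) -> is_internal S ->
  (1 < #|cluster S|)%N.
Proof.
move=> uS; rewrite card_cluster //; case: S {uS} => //= l r _.
by rewrite size_cat (@leq_add 1 1) ?leaves_gt0.
Qed.

Lemma diam_gt0 (A : {set V}) : (1 < #|A|)%N -> (0 < diam G A)%N.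
Proof.
move=> /card_gt1P[x [y [xA yA xy]]]; apply: leq_trans (gdist_gt0 G xy) _.
rewrite /diam; apply: leq_trans (leq_bigmax_cond _ xA).
exact: (@leq_bigmax_cond _ _ (gdist G x) y yA).
Qed.

Lemma diam_le_connected (A : {set V}) : induces_connected G A ->
  (diam G A <= #|A| - 1)%N.
Proof.
move=> cA; apply/bigmax_leqP => x xA; apply/bigmax_leqP => y yA.
exact: gdist_le_connected.
Qed.

(** Below: a connected set of k vertices has diameter at most k - 1. Above: an internal cluster has
    two distinct vertices, hence diameter at least 1. *)
Lemma node_ratio_bounds S : uniq (leaves S) -> is_internal S ->
    induces_connected G (cluster S) ->
  1 <= node_ratio G S <= (#|V| - 1)%N%:R.
Proof.
move=> uS iS cS; have d0 := diam_gt0 _ (card_internal_gt1 _ uS iS).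
have dR : 0 < node_diam G S by rewrite ltr0n.
rewrite /node_ratio ler_pdivlMr // mul1r ler_nat diam_le_connected //=.
rewrite ler_pdivrMr // -natrM ler_nat.
apply: (@leq_trans (#|V| - 1)%N); first by rewrite leq_sub2r ?max_card.
by rewrite leq_pmulr.
Qed.

Lemma cut_weight_ge0 S : 0 <= cut_weight G S.
Proof.
case: S => //= l r; apply: sumr_ge0 => x _; apply: sumr_ge0 => y /andP[_ xy].
exact/ltW/wt_gt0.
Qed.

Lemma node_mass_ge0 S : 0 <= node_mass G S.
Proof. by rewrite mulr_ge0 ?cut_weight_ge0 // ler0n. Qed.

Definition edge_lt x y := adj G x y && (enum_rank x < enum_rank y)%N.

(** Reconciles two conventions: [edge_sum] meets an edge only in the order of [enum_rank], while
    [cut_weight] runs over the adjacent pairs from one side to the other. Each such pair is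
    increasing in exactly one of its two orders. *)
Lemma edge_lt_cut (s1 s2 : seq V) :
  \sum_(x <- s1) \sum_(y <- s2 | edge_lt x y) wt G x y +
  \sum_(x <- s2) \sum_(y <- s1 | edge_lt x y) wt G x y =
  \sum_(x <- s1) \sum_(y <- s2 | adj G x y) wt G x y.
Proof.
rewrite [X in _ + X](exchange_big_dep xpredT) //= -big_split /=.
apply: eq_bigr => x _; rewrite [X in X + _]big_mkcond [X in _ + X]big_mkcond.
rewrite [RHS]big_mkcond -big_split /=; apply: eq_bigr => y _.
rewrite /edge_lt (adj_sym G y x); case: ifP => /andP; case: ifP => /andP.
- by move=> [_ yx] [_ xy]; have := ltn_trans xy yx; rewrite ltnn.
- by move=> _ [-> _]; rewrite addr0.
- by move=> [xy _] _; rewrite xy add0r wt_sym // adj_sym.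
move=> nyx nxy; rewrite addr0; case: ifP => // xy.
have [xy'|yx|/val_inj/enum_rank_inj xy'] := ltngtP (enum_rank x) (enum_rank y).
- by case: nxy.
- by case: nyx.
- by move: xy; rewrite xy' adj_irrefl.
Qed.

(** Induction on [T]: pairs inside one child are handled by that child, and pairs split by the root
    all have the root cluster as lca cluster. Summing over leaves instead of [V] lets the induction
    descend to subtrees; a general [f] covers both the diameter and the cardinality cost. *)
Lemma sum_lca_cluster (f : {set V} -> R) T : uniq (leaves T) ->
  \sum_(x <- leaves T) \sum_(y <- leaves T | edge_lt x y)
     wt G x y * f (lca_cluster T x y) =
  \sum_(S <- internal_nodes T) f (cluster S) * cut_weight G S.
Proof.
elim: T => [a|l IHl r IHr] uT.
  by rewrite /internal_nodes /= big_nil big_seq1 big_mkcond big_seq1 /edge_lt adj_irrefl.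
have {uT} [ul ur rl] : [/\ uniq (leaves l), uniq (leaves r) &
    forall x, x \in leaves r -> x \in leaves l = false].
  move: uT; rewrite /= cat_uniq => /and3P[-> /hasPn h ->]; split => // x.
  by move=> /h /negbTE.
have lr x : x \in leaves l -> x \in leaves r = false.
  by move=> xl; apply/negP => /rl; rewrite xl.
pose F x y := wt G x y * f (lca_cluster (BNode l r) x y).
rewrite -[LHS]/(\sum_(x <- leaves l ++ leaves r)
  \sum_(y <- leaves l ++ leaves r | edge_lt x y) F x y).
have Fl x y : x \in leaves l -> y \in leaves l -> F x y = wt G x y * f (lca_cluster l x y).
  by move=> xl yl; rewrite /F /= xl yl.
have Fr x y : x \in leaves r -> y \in leaves r -> F x y = wt G x y * f (lca_cluster r x y).
  by move=> xr yr; rewrite /F /= xr yr rl.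
have Flr x y : x \in leaves l -> y \in leaves r ->
    F x y = wt G x y * f (cluster (BNode l r)).
  by move=> xl yr; rewrite /F /= xl (rl y) // (lr x).
have Frl x y : x \in leaves r -> y \in leaves l ->
    F x y = wt G x y * f (cluster (BNode l r)).
  by move=> xr yl; rewrite /F /= xr (rl x) // (lr y).
have eqF (s1 s2 : seq V) (g : V -> V -> R) :
    (forall x y, x \in s1 -> y \in s2 -> F x y = wt G x y * g x y) ->
    \sum_(x <- s1) \sum_(y <- s2 | edge_lt x y) F x y =
    \sum_(x <- s1) \sum_(y <- s2 | edge_lt x y) wt G x y * g x y.
  move=> h; rewrite big_seq [RHS]big_seq; apply: eq_bigr => x xs.
  by rewrite big_seq_cond [RHS]big_seq_cond; apply: eq_bigr => y /andP[ys _]; exact: h.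
rewrite internal_nodes_node big_cons !big_cat /= -IHl // -IHr //.
under eq_bigr do rewrite big_cat /=.
under [X in _ + X = _]eq_bigr do rewrite big_cat /=.
rewrite !big_split /= (eqF _ _ _ Fl) (eqF _ _ _ Fr) (eqF _ _ _ Flr) (eqF _ _ _ Frl).
(* Of the four blocks of pairs, the two diagonal ones are the induction hypotheses; the two crossing
   ones must give the root term. *)
rewrite [X in _ + X]addrC addrACA [LHS]addrC; congr (_ + _).
have -> : \sum_(x in cluster l) \sum_(y in cluster r | adj G x y) wt G x y =
    \sum_(x <- leaves l) \sum_(y <- leaves r | adj G x y) wt G x y.
  rewrite [RHS]big_uniq //=; apply: eq_big => [x|x _]; first by rewrite inE.
  rewrite big_mkcondr [RHS]big_mkcond [RHS]big_uniq //=.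
  by apply: eq_bigl => y; rewrite inE.
rewrite -edge_lt_cut mulrC mulrDl !mulr_suml.
by congr (_ + _); apply: eq_bigr => x _; rewrite mulr_suml.
Qed.

Lemma edge_sum_lca (f : {set V} -> R) T : is_hierarchy T ->
  edge_sum G (fun x y => f (lca_cluster T x y)) =
  \sum_(S <- internal_nodes T) f (cluster S) * cut_weight G S.
Proof.
move=> hT; have uT : uniq (leaves T) by rewrite (perm_uniq hT) enum_uniq.
rewrite -sum_lca_cluster // (perm_big _ hT) /= big_enum; apply: eq_bigr => x _.
by rewrite (perm_big _ hT) /= big_enum_cond; apply: eq_bigl => y.
Qed.

Lemma edge_sum_card_height T : is_hierarchy T ->
  edge_sum G (fun x y => (card_height T x y)%:R) =
  \sum_(S <- internal_nodes T) (#|cluster S| - 1)%N%:R * cut_weight G S.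
Proof.
move=> hT; rewrite -(edge_sum_lca (fun A => (#|A| - 1)%N%:R)) //.
apply: eq_bigr => x _; apply: eq_bigr => y /andP[xy _].
(* The separate value of [card_height] at [x = y] is never met, an edge having distinct ends. *)
by rewrite /card_height; case: eqVneq xy => // ->; rewrite adj_irrefl.
Qed.

Lemma Fcost_nodes T : is_hierarchy T ->
  Fcost G T = \sum_(S <- internal_nodes T) node_mass G S.
Proof. by move=> hT; rewrite -(edge_sum_lca (fun A => (diam G A)%:R)). Qed.

Lemma internal_node_ratio_bounds T : conn_hierarchy G T ->
  all (fun S => 1 <= node_ratio G S <= (#|V| - 1)%N%:R) (internal_nodes T).
Proof.
move=> /andP[hT cT].
have uT : uniq (leaves T) by rewrite (perm_uniq hT) enum_uniq.
rewrite all_filter; have := uniq_leaves_nodes _ uT; move: cT.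
elim: (nodes T) => //= S s IH /andP[cS cs] /andP[uS us]; rewrite IH // andbT.
by apply/implyP => iS; exact: node_ratio_bounds.
Qed.

End Hierarchy.

(** * Comparison of the two optima *)

Theorem theorem18 (R : realType) (V : finType) (G : wgraph R V)
  (hV : (2 <= #|V|)%N) (hG : connected_graph G)
  (T : btree V) (hT : conn_hierarchy G T)
  (alpha : R) (halpha : 1 <= alpha)
  (hF : Fcost G T <= alpha * OPT_free G)
  (Phi : R -> R)
  (hPhi0 : forall t, 1 <= t <= (#|V| - 1)%N%:R -> 0 <= Phi t)
  (hPhi : forall t, 1 <= t <= (#|V| - 1)%N%:R ->
    mu G T (fun S => t < node_ratio G S) <= Phi t) :
  ((OPT_card G)%:E <=
     alpha%:E *
     (1 + \int[lebesgue_measure]_(t in `[1%R, (#|V| - 1)%N%:R]%classic)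
            (Phi t)%:E) *
     (OPT_free G)%:E)%E.
Proof.
have [hierT _] := andP hT.
(* Positions in the list of internal nodes form the finite index type that [layer_cake] asks for. *)
pose S i := tnth (in_tuple (internal_nodes T)) i.
pose r i := node_ratio G (S i); pose m i := node_mass G (S i) / Fcost G T.
have rb i : 1 <= r i <= (#|V| - 1)%N%:R.
  move: i; apply/(@all_tnthP _ _ (fun U => 1 <= node_ratio G U <= (#|V| - 1)%N%:R)).
  exact: internal_node_ratio_bounds.
have FE : Fcost G T = \sum_i node_mass G (S i).
  by rewrite Fcost_nodes // big_tnth.
have F0 : 0 <= Fcost G T by rewrite FE sumr_ge0 // => i _; exact: node_mass_ge0.
have m0 i : 0 <= m i by rewrite divr_ge0 ?node_mass_ge0.
(* Also valid when F = 0, where m is 0 by the convention x / 0 = 0. *)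
have Fm i : Fcost G T * m i = node_mass G (S i).
  rewrite mulrC; have [F00|/divfK -> //] := eqVneq (Fcost G T) 0.
  move: FE; rewrite F00 mulr0 => /esym/eqP; rewrite psumr_eq0 => [/allP h|j _].
    by rewrite (eqP (h i (mem_index_enum i))).
  exact: node_mass_ge0.
have cardE : edge_sum G (fun x y => (card_height T x y)%:R) =
    Fcost G T * (1 + \sum_i m i * (r i - 1)).
  rewrite edge_sum_card_height // big_tnth mulrDr mulr1 mulr_sumr {1}FE -big_split /=.
  apply: eq_bigr => i _; rewrite mulrA Fm mulrBr mulr1 addrC subrK.
  rewrite /node_mass mulrAC; congr (_ * _).
  rewrite /r /node_ratio -/(S i) mulrC divfK //.
  (* A zero diameter would make the ratio 0, by the convention on division, against [1 <= r i]. *)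
  apply/eqP => d0; have := rb i; rewrite /r /node_ratio d0 invr0 mulr0.
  by rewrite ler10.
have cardle : OPT_card G <= Fcost G T * (1 + \sum_i m i * (r i - 1)).
  rewrite -cardE; apply: (OPT_card_min hT).2; exists T => //; split => // x y.
  exact: conn_hierarchy_feasible.
have intle : (1 + (\sum_i m i * (r i - 1))%:E <=
    1 + \int[lebesgue_measure]_(t in `[1%R, (#|V| - 1)%N%:R]%classic) (Phi t)%:E)%E.
  rewrite leeD2l // -(layer_cake _ _ _ _ _ m0 rb).
  apply: le_integral_ge0 => t /=; rewrite in_itv /= lee_fin => ht.
    by rewrite sumr_ge0.
  by apply: le_trans (hPhi t ht); rewrite /mu [leRHS]big_tnth.
(* The integral of [Phi] may be infinite, so the finite factors are gathered first; their product is
   nonnegative because it dominates [Fcost G T]. *)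
rewrite muleAC -EFinM; apply: (@le_trans _ _ ((alpha * OPT_free G)%:E *
    (1 + (\sum_i m i * (r i - 1))%:E))%E); last first.
  by rewrite lee_wpmul2l // lee_fin (le_trans F0).
rewrite -EFinD -EFinM lee_fin (le_trans cardle) // ler_wpM2r //.
rewrite addr_ge0 // sumr_ge0 // => i _; rewrite mulr_ge0 // subr_ge0.
by case/andP: (rb i).
Qed.
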